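(* Let $(X,f)$ be a dynamical system, where $X$ is a compact Hausdorff space, and let $\mathscr{U}$ be the unique uniformity inducing the topology of $X$. Then for any $E \in \mathscr{U}$ there exist $n \in \mathbb{N}$ and $D \in \mathscr{U}$ such that given any $D$-pseudo-orbit $(x_i)_{i \geq 0}$ there exists $z\in X$ such that \[B_E\left(\{x_i\}_{i=0}^n \right) \supseteq \omega(z).\] In particular, \[B_E\left(\{x_i\}_{i \geq 0}\right) \supseteq \omega(z).\]
   Context: A dynamical system is a pair $(X,f)$ with $X$ a (nonempty) compact Hausdorff space and $f\colon X\to X$ a continuous function. A compact Hausdorff space has a unique uniformity $\mathscr{U}$ inducing its topology. Since symmetric entourages form a base for $\mathscr{U}$, all entourages referred to are taken to be symmetric ($E=E^{-1}$). For $E\in\mathscr{U}$, $x\in X$ and $A\subseteq X$: $B_E(x)=\{y\in X \mid (x,y)\in E\}$ and $B_E(A)=\bigcup_{x\in A}B_E(x)$. For $D\in\mathscr{U}$, a $D$-pseudo-orbit is a sequence $(x_i)_{i\ge 0}$ in $X$ with $(f(x_i),x_{i+1})\in D$ for all $i\ge 0$. The $\omega$-limit set of $z\in X$ under $f$ is $\omega(z)=\bigcap_{N\in\mathbb{N}}\overline{\{f^n(z)\mid n>N\}}$. *)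

(* Defs.v *)
From mathcomp Require Import all_boot.
From mathcomp Require Import classical_sets topology.

Set Implicit Arguments.
Unset Strict Implicit.
Unset Printing Implicit Defensive.

Local Open Scope classical_set_scope.

(* A compact Hausdorff space has exactly one uniformity inducing its topology,
   so the uniformity carried by [X] is that one: [nbhs] is by construction the
   topology generated by [entourage]. *)
Definition dynamical_system (X : uniformType) (f : X -> X) : Prop :=
  [/\ [set: X] !=set0, compact [set: X], hausdorff_space X & continuous f].

Definition symmetric_entourage (X : uniformType) (E : set (X * X)) : Prop :=
  entourage E /\ E^-1%relation = E.

(* [xsection E x] is B_E(x) = [set y | (x, y) \in E]. *)
Definition entourage_nbhd (X : Type) (E : set (X * X)) (A : set X) : set X :=
  \bigcup_(x in A) xsection E x.

Definition pseudo_orbit (X : Type) (f : X -> X) (D : set (X * X))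
    (x : nat -> X) : Prop :=
  forall i, D (f (x i), x i.+1).

Definition omega_limit (X : topologicalType) (f : X -> X) (z : X) : set X :=
  \bigcap_(N in [set: nat]) closure [set iter n f z | n in [set n | N < n]].

(* Main.v *)
Require Import Defs.
From mathcomp Require Import all_boot.
From mathcomp Require Import classical_sets topology.

(** The point [z] can be taken near [x 0].  Fix [y : X].  Every point of
    [omega_limit f y] is a limit of iterates of [y], so by compactness a finite
    orbit segment [y, ..., f^N(y)] already comes close to every point of
    [omega_limit f y] ([omega_limit_near_segment]).  By continuity of [f], a
    sufficiently fine pseudo-orbit starting sufficiently close to [y] follows
    this finite segment ([pseudo_orbit_track]), so its first [N + 1] points
    approximate [omega_limit f y] as well ([pseudo_orbit_covers_near]).

    The length [N] and the fineness depend on [y], but they work for all initial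
    points in a neighbourhood of [y], and they can only be improved by enlarging
    [N] and shrinking the entourage.  Compactness of [X] therefore makes them
    uniform.  Both compactness arguments use the near-covering form of
    compactness: a property holding locally along a filter holds globally along
    it. *)

Local Open Scope classical_set_scope.

(** A fine pseudo-orbit follows a finite segment of the true orbit. *)
Lemma pseudo_orbit_track (X : uniformType) (f : X -> X) (y : X) (N : nat)
    (E : set (X * X)) :
  continuous f -> entourage E ->
  exists (U : set X) (D : set (X * X)), [/\ nbhs y U, entourage D &
    forall x : nat -> X, U (x 0) -> pseudo_orbit f D x ->
      forall i, i <= N -> E (iter i f y, x i)].
Proof.
move=> cf; elim: N E => [|N IHN] E entE.
  exists (xsection E y), E; split => //.
  by move=> x /xsectionP Ex0 _ [].
have entE2 : entourage (split_ent E) by [].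
have : nbhs (iter N f y) (f @^-1` xsection (split_ent E) (f (iter N f y))).
  by apply: cf; exact: nbhs_entourage.
move=> /nbhsP[V entV sV].
have [U [D [nU entD UD]]] := IHN _ (filterI entV entE).
exists U, (D `&` split_ent E); split => //; first exact: filterI.
move=> x Ux xD.
have {}UD : forall i, i <= N -> (V `&` E) (iter i f y, x i).
  by apply: UD => // i; have [] := xD i.
move=> i; rewrite leq_eqVlt => /predU1P[->|]; last first.
  by rewrite ltnS => /UD[].
have [Vx _] := UD N (leqnn N).
have [_ Dx] := xD N.
apply: (entourage_split (f (x N))) => //=.
by apply/xsectionP; apply: sV; apply/xsectionP.
Qed.

Lemma omega_limit_near_segment (X : uniformType) (f : X -> X) (y : X)
    (E : set (X * X)) :
  compact [set: X] -> entourage E ->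
  exists N : nat, forall p, omega_limit f y p ->
    exists2 i, i <= N & E (iter i f y, p).
Proof.
move=> cX entE.
have entV : entourage (split_ent E) by [].
have cw : compact (omega_limit f y).
  apply: (subclosed_compact _ cX) => //.
  by apply: closed_bigI => N _; exact: closed_closure.
pose P N p := exists2 i, i <= N & E (iter i f y, p).
have [|N _ NP] := (compact_near_coveringP _).1 cw nat \oo P _ _.
  move=> p wp.
  (* The inverse is needed because [split_ent E] need not be symmetric. *)
  have nV : nbhs p (xsection (split_ent E)^-1%relation p).
    by apply: nbhs_entourage; exact: entourage_inv.
  have [_ [[i _ <-] /xsectionP pi]] := wp 0 I _ nV.
  exists (xsection (split_ent E) p, [set N | i <= N]) => /=.
    by split; [exact: nbhs_entourage|exists i].
  move=> [q N] /= [/xsectionP pq iN]; exists i => //.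
  exact: entourage_split pi pq.
by exists N => p wp; exact: (NP N (leqnn N)).
Qed.

Lemma pseudo_orbit_covers_near (X : uniformType) (f : X -> X) (y : X)
    (E : set (X * X)) :
  compact [set: X] -> continuous f -> entourage E ->
  exists (N : nat) (U : set X) (D : set (X * X)), [/\ nbhs y U, entourage D &
    forall x : nat -> X, U (x 0) -> pseudo_orbit f D x ->
      omega_limit f y `<=`
        entourage_nbhd E [set x i | i in [set i | i <= N]]].
Proof.
move=> cX cf entE.
have entE2 : entourage (split_ent E) by [].
have [N wN] := omega_limit_near_segment _ f y _ cX entE2.
have [U [D [nU entD UD]]] :=
  pseudo_orbit_track _ f y N _ cf (entourage_inv entE2).
exists N, U, D; split => // x Ux xD p /wN[i iN ip].
exists (x i); first by exists i.
by apply/xsectionP; apply: entourage_split ip => //; exact: (UD x).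
Qed.

Theorem theorem2p3 (X : uniformType) (f : X -> X) (hf : dynamical_system f)
    (E : set (X * X)) (hE : symmetric_entourage E) :
  exists (n : nat) (D : set (X * X)), symmetric_entourage D /\
    forall x : nat -> X, pseudo_orbit f D x ->
      exists z : X,
        omega_limit f z `<=` entourage_nbhd E [set x i | i in [set i | i <= n]]
        /\ omega_limit f z `<=` entourage_nbhd E [set x i | i in [set: nat]].
Proof.
have [[x0 _] cX _ cf] := hf; have [entE _] := hE.
(* The parameter [ND] runs along arbitrarily large lengths and arbitrarily small
   entourages; the property is asked of the initial point [y]. *)
pose P (ND : nat * set (X * X)) (y : X) := forall x : nat -> X,
  x 0 = y -> pseudo_orbit f ND.2 x -> exists z : X,
    omega_limit f z `<=` entourage_nbhd E [set x i | i in [set i | i <= ND.1]].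
(* Needed for the small entourages to form a filter; [X] is nonempty. *)
have PFent : ProperFilter (@entourage X).
  apply: Build_ProperFilter_ex => D entD.
  by exists (x0, x0); exact: entourage_refl.
have [|[A B] /= [[n _ nA] entB] AB] :=
    (compact_near_coveringP _).1 cX _
      (filter_prod \oo (powerset_filter_from (@entourage X))) P _ _.
  move=> y _.
  have [N [U [D [nU entD UD]]]] := pseudo_orbit_covers_near _ f y _ cX cf entE.
  exists (U, [set ND : nat * set (X * X) | N <= ND.1 /\ ND.2 `<=` D]) => /=.
    split=> //.
    exists ([set M | N <= M], [set D' | D' `<=` D]) => /=.
      split; first by exists N.
      apply/near_powerset_filter_fromP; last by exists D.
      by move=> ? ?; exact: subset_trans.
    by move=> [].
  move=> [u [M D']] /= [Uu [NM D'D]] x xu xD'.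
  exists y => p wp.
  have [|_ [i iN <-] ip] := UD x _ (fun i => D'D _ (xD' i)) p wp.
    by rewrite xu.
  by exists (x i) => //; exists i => //; exact: leq_trans NM.
have [D entD BD] : exists2 D, entourage D & B D.
  have [M [sM _ [D MD]] MB] := entB.
  by exists D; [exact: sM|exact: MB].
exists n, (D `&` D^-1%relation); split.
  split; first by apply: filterI => //; exact: entourage_inv.
  by apply/seteqP; split=> -[a b] [].
move=> x xD.
have [|z wz] := AB (n, D) (conj (nA n (leqnn n)) BD) (x 0) I x erefl.
  by move=> i; have [] := xD i.
exists z; split=> // p /wz[_ [i _ <-] ip].
by exists (x i) => //; exists i.
Qed.
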